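(* Let $\mathbf{k}$ be a commutative ring, let $k\in\mathbb{N}$, and let $n\geq k$ be an integer. Let $\mathcal{S}$ be the ring of symmetric polynomials in $\mathbf{k}[x_1,\ldots,x_k]$. For each $i\in\{1,2,\ldots,k\}$, let $a_i\in\mathcal{S}$ be a symmetric polynomial of degree $<n-k+i$. Let $I$ be the ideal of $\mathcal{S}$ generated by $h_{n-k+1}-a_1,\ h_{n-k+2}-a_2,\ \ldots,\ h_n-a_k$. Then the family $\left(\overline{h_\lambda}\right)_{\lambda\in P_{k,n}}$ is a basis of the $\mathbf{k}$-module $\mathcal{S}/I$.
   Context: The degree of a polynomial is its total degree; the zero polynomial counts as having degree smaller than every integer. $h_m$ is the $m$-th complete homogeneous symmetric polynomial in $x_1,\ldots,x_k$. For a partition $\lambda=(\lambda_1,\ldots,\lambda_\ell)$, $h_\lambda=h_{\lambda_1}h_{\lambda_2}\cdots h_{\lambda_\ell}\in\mathcal{S}$. $P_{k,n}$ is the set of all partitions with at most $k$ parts, all of which are $\leq n-k$. $\overline{m}$ denotes the residue class of $m\in\mathcal{S}$ in $\mathcal{S}/I$. *)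

(* Defs.v *)
From HB Require Import structures.
From mathcomp Require Import all_boot all_order all_fingroup all_algebra.
From mathcomp Require Import boolp.
From mathcomp.multinomials Require Import mpoly.

Set Implicit Arguments.
Unset Strict Implicit.
Unset Printing Implicit Defensive.

Import GRing.Theory.
Local Open Scope ring_scope.
Local Open Scope quotient_scope.

Record sympoly (k : nat) (R : comNzRingType) : Type := SymPoly {
  sympoly_val :> {mpoly R[k]};
  sympolyP : sympoly_val \in @symmetric_pred k R
}.

Section SymPoly.
Variables (k : nat) (R : comNzRingType).

HB.instance Definition _ := [isSub for @sympoly_val k R].
HB.instance Definition _ := [Choice of sympoly k R by <:].
HB.instance Definition _ :=
  [SubChoice_isSubComNzRing of sympoly k R by <:].
HB.instance Definition _ :=
  [SubZmodule_isSubLmodule of sympoly k R by <:].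
HB.instance Definition _ :=
  [SubNzRing_SubLmodule_isSubLalgebra of sympoly k R by <:].
HB.instance Definition _ :=
  [SubLalgebra_isSubAlgebra of sympoly k R by <:].

(* The complete homogeneous symmetric polynomial; the index type is           *)
(* restricted to monomials of degree < d.+1 only to make it finite.           *)
Definition hpoly (d : nat) : {mpoly R[k]} :=
  \sum_(m : 'X_{1..k < d.+1} | mdeg m == d) 'X_[m].

Lemma mcoeff_hpoly d (m : 'X_{1..k}) : (hpoly d)@_m = (mdeg m == d)%:R.
Proof.
rewrite /hpoly raddf_sum /=.
under eq_bigr do rewrite mcoeffX.
have [dm|dm] := eqVneq (mdeg m) d; last first.
  rewrite big1 // => i /eqP di; case: eqP => // im.
  by rewrite -im di eqxx in dm.
have lt_md : (mdeg m < d.+1)%N by rewrite dm.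
rewrite (bigD1 (BMultinom lt_md)) ?dm ?eqxx //= big1 ?addr0 // => i /andP[_ ne].
case: eqP => // im; case/eqP: ne; exact: val_inj.
Qed.

Lemma hpoly_sym d : hpoly d \in @symmetric_pred k R.
Proof.
apply/issymP => s; apply/mpolyP => m.
by rewrite mcoeff_sym !mcoeff_hpoly mdeg_mperm.
Qed.

Definition hsym (d : nat) : sympoly k R := SymPoly (hpoly_sym d).

Definition hsym_part (la : seq nat) : sympoly k R := \prod_(d <- la) hsym d.

End SymPoly.

Notation "{ 'sympoly' R [ k ] }" := (sympoly k R)
  (at level 0, R, k at level 2, format "{ 'sympoly'  R [ k ] }") : type_scope.

(* Partitions are the lists of their (positive) parts.                        *)

Definition is_partition (la : seq nat) : bool :=
  sorted geq la && (0%N \notin la).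

(* Lists of length at most k with entries in {0, ..., n - k}.                 *)
Definition box_partition (k n : nat) : Type :=
  {la : k.-bseq 'I_(n - k).+1 | is_partition (map val la)}.

HB.instance Definition _ k n := Finite.on (box_partition k n).

Definition parts k n (la : box_partition k n) : seq nat := map val (val la).

(* Since membership in I is undecidable in general, I is made a boolean       *)
(* predicate by excluded middle, as required by the quotient construction.    *)

Section IdealGen.
Variables (R : comNzRingType) (A : comAlgType R) (m : nat) (g : 'I_m -> A).

Definition ideal_gen : pred A :=
  fun x => `[< exists c : 'I_m -> A, x = \sum_(i < m) c i * g i >].

Lemma ideal_gen_mul (x y : A) : y \in ideal_gen -> x * y \in ideal_gen.
Proof.
move=> /asboolP[c ->]; apply/asboolP; exists (fun i => x * c i).
by rewrite mulr_sumr; apply: eq_bigr => i _; rewrite mulrA.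
Qed.

Lemma ideal_gen_submod : submod_closed ideal_gen.
Proof.
split=> [|a x y xI yI].
  by apply/asboolP; exists (fun=> 0); rewrite big1 // => i _; rewrite mul0r.
have /asboolP[c ->] := yI.
have /asboolP[d ->] : a *: x \in ideal_gen.
  by rewrite -mulr_algl; apply: ideal_gen_mul.
apply/asboolP; exists (fun i => d i + c i).
by rewrite -big_split; apply: eq_bigr => i _; rewrite mulrDl.
Qed.

HB.instance Definition _ :=
  GRing.isSubmodClosed.Build R A ideal_gen ideal_gen_submod.

(* The library makes this quotient an abelian group (it gives a ring          *)
(* structure only for proper ideals); the R-action is added here.             *)

Definition ideal_gen_quot : Type :=
  {ideal_quot (GRing.ZmodClosed.clone A ideal_gen _)}.

HB.instance Definition _ := GRing.Zmodule.on ideal_gen_quot.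
HB.instance Definition _ := Quotient.on ideal_gen_quot.

Definition quot_scale (a : R) : ideal_gen_quot -> ideal_gen_quot :=
  lift_op1 ideal_gen_quot ( *:%R a).

Lemma pi_scale a : {morph \pi_ideal_gen_quot : x / a *: x >-> quot_scale a x}.
Proof.
move=> x; unlock quot_scale; apply/eqP.
by rewrite -Quotient.idealrBE -scalerBr rpredZ // Quotient.idealrBE reprK.
Qed.

Lemma pi_addq : {morph \pi_ideal_gen_quot : x y / x + y >-> x + y}.
Proof. exact: Quotient.pi_add. Qed.

Lemma quot_scalerA a b v :
  quot_scale a (quot_scale b v) = quot_scale (a * b) v.
Proof. by rewrite -[v]reprK -!pi_scale scalerA. Qed.

Lemma quot_scale1r : left_id 1 quot_scale.
Proof. by move=> v; rewrite -[v]reprK -pi_scale scale1r. Qed.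

Lemma quot_scalerDr : right_distributive quot_scale +%R.
Proof.
move=> a u v; rewrite -[u]reprK -[v]reprK -pi_addq -!pi_scale.
by rewrite scalerDr pi_addq.
Qed.

Lemma quot_scalerDl v : {morph quot_scale^~ v : a b / a + b}.
Proof.
by move=> a b; rewrite -[v]reprK -!pi_scale scalerDl pi_addq.
Qed.

HB.instance Definition _ := GRing.Zmodule_isLmodule.Build R ideal_gen_quot
  quot_scalerA quot_scale1r quot_scalerDr quot_scalerDl.

End IdealGen.

Definition is_basis (R : nzRingType) (V : lmodType R) (T : finType)
    (b : T -> V) : Prop :=
  (forall c : T -> R, \sum_t c t *: b t = 0 -> forall t, c t = 0) /\
  (forall v : V, exists c : T -> R, v = \sum_t c t *: b t).

(* Main.v *)
Require Import Defs.
From HB Require Import structures.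
From mathcomp Require Import all_boot all_order all_fingroup all_algebra.
From mathcomp Require Import boolp zify ring.
From mathcomp.multinomials Require Import mpoly.

(** Put N = n - k, g_i = h_{N+i} - a_i, and let F be the family of all products
    h_la * g_1^c_1 * ... * g_k^c_k with la a partition in the k x N box. The
    members of F of weight |la| + sum_i (N + i) c_i < D form a basis of the
    symmetric polynomials of degree < D. The members with c <> 0 then span I,
    and those with c = 0 give a basis of the quotient.

    Spanning: every symmetric polynomial is a combination of products h_nu.
    A factor h_m with m > N lies in the ideal (h_{N+1}, ..., h_{N+k}) by the
    recurrence sum_i (-1)^i e_i h_{m-i} = 0, and h_{N+i} = g_i + a_i with a_i of
    smaller degree. If nu has more than k nonzero parts, the same recurrence
    makes the (k+1) x (k+1) determinant det (h_{nu_i - i + j}) vanish, and its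
    expansion rewrites h_nu in terms of products with more concentrated parts.

    Independence: the monomials in e_1, ..., e_k of weight < D form a basis of
    the same module, and there are as many of them as members of F, by the
    q-binomial formula; a spanning family with the cardinality of a basis is
    free over any commutative ring. *)

Set Implicit Arguments.
Unset Strict Implicit.
Unset Printing Implicit Defensive.

Import GRing.Theory.
Local Open Scope ring_scope.
Local Open Scope quotient_scope.

(** * Linear spans and free families *)

Inductive lspan (R : nzRingType) (V : lmodType R) (P : V -> Prop) : V -> Prop :=
| lspan0 : lspan P 0
| lspanS a x y : P x -> lspan P y -> lspan P (a *: x + y).

Section LSpan.
Variables (R : nzRingType) (V : lmodType R).
Implicit Types P Q : V -> Prop.

Lemma lspanD P x y : lspan P x -> lspan P y -> lspan P (x + y).
Proof.
by elim=> [|a u v Pu _ IH] Py; rewrite ?add0r // -addrA; apply: lspanS => //; apply: IH.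
Qed.

Lemma lspanZ P a x : lspan P x -> lspan P (a *: x).
Proof.
elim=> [|b u v Pu _ IH]; first by rewrite scaler0; apply: lspan0.
by rewrite scalerDr scalerA; apply: lspanS.
Qed.

Lemma lspanN P x : lspan P x -> lspan P (- x).
Proof. by rewrite -scaleN1r; apply: lspanZ. Qed.

Lemma lspan_gen P x : P x -> lspan P x.
Proof.
by move=> Px; rewrite -[x]addr0 -[x]scale1r; apply: lspanS => //; apply: lspan0.
Qed.

Lemma lspan_sum P (I : Type) (r : seq I) (p : pred I) (F : I -> V) :
  (forall i, p i -> lspan P (F i)) -> lspan P (\sum_(i <- r | p i) F i).
Proof. by move=> H; apply: big_ind => //; [apply: lspan0 | apply: lspanD]. Qed.

Lemma lspan_trans P Q x :
  (forall y, P y -> lspan Q y) -> lspan P x -> lspan Q x.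
Proof.
move=> PQ; elim=> [|a u v Pu _ IH]; first exact: lspan0.
by apply: lspanD => //; apply/lspanZ/PQ.
Qed.

Lemma lspan_family P (I : finType) (u : I -> V) (p : pred I) x :
    (forall y, P y -> exists2 i, p i & y = u i) -> lspan P x ->
  exists2 c : I -> R, (forall i, ~~ p i -> c i = 0) & x = \sum_i c i *: u i.
Proof.
move=> Pu; elim=> [|a y z /Pu[i pi ->] _ [c c0 ->]].
  by exists (fun=> 0) => //; rewrite big1 // => i _; rewrite scale0r.
exists (fun j => (if j == i then a else 0) + c j) => [j pj|].
  by rewrite c0 // addr0; case: eqP => // E; rewrite E pi in pj.
under [RHS]eq_bigr do rewrite scalerDl.
rewrite big_split /=; congr (_ + _).
by rewrite (bigD1 i) //= eqxx big1 ?addr0 // => j /negPf->; rewrite scale0r.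
Qed.

End LSpan.

Lemma lspanM (R : comNzRingType) (A : comAlgType R) (P Q T : A -> Prop) x y :
  (forall u v, P u -> Q v -> lspan T (u * v)) ->
  lspan P x -> lspan Q y -> lspan T (x * y).
Proof.
move=> PQT sPx; elim=> [|a u v Qu _ IH]; first by rewrite mulr0; apply: lspan0.
rewrite mulrDr; apply: lspanD => //; rewrite -scalerAr; apply: lspanZ.
elim: sPx => [|b w z Pw _ IHz]; first by rewrite mul0r; apply: lspan0.
by rewrite mulrDl -scalerAl; apply: lspanD => //; apply/lspanZ/PQT.
Qed.

Definition free_family (R : nzRingType) (V : lmodType R) (I : finType)
    (u : I -> V) : Prop :=
  forall c : I -> R, \sum_i c i *: u i = 0 -> forall i, c i = 0.

Section SpanningFree.
Variables (R : comNzRingType) (V : lmodType R).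

(** [L] writes [v] in terms of [u], and [M] writes [u] in terms of [v]. Freeness of [v] gives
    [L *m M = 1], hence [M *m L = 1] for square matrices over a commutative ring. A relation [C]
    among the [u i] satisfies [C *m M = 0], so [C = 0]. *)
Lemma ord_spanning_free m (u v : 'I_m -> V) : free_family v ->
    (forall i, exists c : 'I_m -> R, u i = \sum_j c j *: v j) ->
    (forall j, exists c : 'I_m -> R, v j = \sum_i c i *: u i) ->
  free_family u.
Proof.
move=> fv /choice[a ua] /choice[b vb] c cu0.
pose M := \matrix_(i, j) a i j; pose L := \matrix_(i, j) b i j.
have exchange (x y : 'I_m -> 'I_m -> R) (w : 'I_m -> V) i :
    \sum_j x i j *: (\sum_l y j l *: w l)
    = \sum_l (\sum_j x i j * y j l) *: w l.
  under eq_bigr do rewrite scaler_sumr.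
  rewrite exchange_big; apply: eq_bigr => l _.
  by rewrite scaler_suml; apply: eq_bigr => j _; rewrite scalerA.
have LM : L *m M = 1%:M.
  apply/matrixP => i l; rewrite !mxE; apply/eqP; rewrite -subr_eq0; apply/eqP.
  apply: (fv (fun l => (\sum_j L i j * M j l) - (i == l)%:R)).
  under eq_bigr do rewrite scalerBl.
  rewrite sumrB [X in _ - X](bigD1 i) //= eqxx scale1r [X in _ - (_ + X)]big1.
    rewrite addr0 [v i]vb; under [X in _ - X]eq_bigr do rewrite ua.
    rewrite exchange; apply/eqP; rewrite subr_eq0; apply/eqP.
    by apply: eq_bigr => j _; congr (_ *: _); apply: eq_bigr => ? _; rewrite !mxE.
  by move=> j /negPf; rewrite eq_sym => ->; rewrite scale0r.
have ML := mulmx1C LM.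
pose C := \row_i c i.
have CM : C *m M = 0.
  apply/rowP => l; rewrite !mxE; apply: (fv (fun l => \sum_j C 0 j * M j l)).
  rewrite -[RHS]cu0; under [RHS]eq_bigr do rewrite ua.
  rewrite (exchange (fun _ => c) a v l).
  by apply: eq_bigr => j _; congr (_ *: _); apply: eq_bigr => ? _; rewrite !mxE.
have C0 : C = 0 by rewrite -[C]mulmx1 -ML mulmxA CM mul0mx.
by move=> i; move/rowP/(_ i): C0; rewrite !mxE.
Qed.

Lemma spanning_free (I J : finType) (u : I -> V) (v : J -> V) :
    #|I| = #|J| -> free_family v ->
    (forall i, exists c : J -> R, u i = \sum_j c j *: v j) ->
    (forall j, exists c : I -> R, v j = \sum_i c i *: u i) ->
  free_family u.
Proof.
move=> IJ fv uv vu.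
pose f (x : 'I_#|J|) : I := enum_val (cast_ord (esym IJ) x).
pose f' (i : I) : 'I_#|J| := cast_ord IJ (enum_rank i).
have fK : cancel f f' by move=> x; rewrite /f /f' enum_valK cast_ordKV.
have f'K : cancel f' f by move=> x; rewrite /f /f' cast_ordK enum_rankK.
have fb : bijective f by exists f'.
have gb : bijective (@enum_val J predT) 
  by exists enum_rank; [apply: enum_valK | apply: enum_rankK].
have sumf (c : I -> R) : \sum_i c i *: u i = \sum_x c (f x) *: u (f x).
  by rewrite (reindex f) //; apply: onW_bij.
have sumg (c : J -> R) :
    \sum_j c j *: v j = \sum_(x < #|J|) c (enum_val x) *: v (enum_val x).
  by rewrite (reindex (@enum_val J predT)) //; apply: onW_bij.
have H : free_family (u \o f).
  apply: (@ord_spanning_free _ _ (v \o (@enum_val J predT))).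
  - move=> c c0 x.
    have := fv (c \o enum_rank); rewrite sumg.
    under eq_bigr do rewrite /= enum_valK.
    by move=> /(_ c0)/(_ (enum_val x)); rewrite /= enum_valK.
  - by move=> x; have [c /= ->] := uv (f x); exists (c \o enum_val); rewrite sumg.
  - by move=> x; have [c /= ->] := vu (enum_val x); exists (c \o f); rewrite sumf.
move=> c; rewrite sumf => /(H (c \o f)) c0 i.
by have := c0 (f' i); rewrite /= f'K.
Qed.

End SpanningFree.

(** * Straightening products of complete homogeneous polynomials *)

Definition in_box (N k : nat) (la : seq nat) : bool :=
  [&& is_partition la, (size la <= k)%N & all (leq^~ N) la].

Lemma mulr_signZ (R : nzRingType) (A : lalgType R) n (x : A) :
  (-1) ^+ n * x = ((-1) ^+ n : R) *: x.
Proof. by rewrite -signr_odd mulr_sign -scaler_sign signr_odd. Qed.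

Section Straightening.
Variables (R : comNzRingType) (A : comAlgType R) (k N : nat) (h e : nat -> A).

Definition hmon (nu : seq nat) : A := \prod_(d <- nu) h d.

(* Entries of nu may be 0, as h 0 = 1 below. *)
Definition hspan (d : nat) : A -> Prop :=
  lspan (fun x => exists2 nu, (sumn nu <= d)%N & x = hmon nu).

Lemma hmon_cat mu nu : hmon (mu ++ nu) = hmon mu * hmon nu.
Proof. by rewrite /hmon big_cat. Qed.

Lemma hmon_perm mu nu : perm_eq mu nu -> hmon mu = hmon nu.
Proof. by move=> mn; rewrite /hmon (perm_big _ mn). Qed.

Lemma hspanW d d' x : (d <= d')%N -> hspan d x -> hspan d' x.
Proof.
move=> dd'; apply: lspan_trans => y [nu nud ->].
by apply: lspan_gen; exists nu => //; apply: leq_trans dd'.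
Qed.

Lemma hspanM d d' x y : hspan d x -> hspan d' y -> hspan (d + d') (x * y).
Proof.
apply: lspanM => u v [mu md ->] [nu nd ->]; apply: lspan_gen.
by exists (mu ++ nu); rewrite ?hmon_cat // sumn_cat leq_add.
Qed.

Lemma hspan1 d : hspan d 1.
Proof. by apply: lspan_gen; exists [::]; rewrite /hmon ?big_nil. Qed.

Lemma hspan_h d : hspan d (h d).
Proof. by apply: lspan_gen; exists [:: d]; rewrite /hmon ?big_seq1 //= addn0. Qed.

Lemma hspanX d x m : hspan d x -> hspan (m * d) (x ^+ m).
Proof.
move=> hx; elim: m => [|m IH]; first by rewrite expr0; apply: hspan1.
by rewrite exprS mulSn; apply: hspanM.
Qed.

Lemma hspan_prod (I : Type) (r : seq I) (d : I -> nat) (x : I -> A) :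
  (forall i, hspan (d i) (x i)) ->
  hspan (\sum_(i <- r) d i)%N (\prod_(i <- r) x i).
Proof.
move=> H; elim: r => [|i r IH]; first by rewrite !big_nil; apply: hspan1.
by rewrite !big_cons; apply: hspanM.
Qed.

Hypothesis h0 : h 0 = 1.
Hypothesis e0 : e 0 = 1.
Hypothesis eh : forall m, (0 < m)%N ->
  \sum_(i < k.+1 | (i <= m)%N) (-1) ^+ i * (e i * h (m - i)) = 0.

Lemma eh_rec m : (0 < m)%N ->
  h m = - \sum_(i < k | (i < m)%N) (-1) ^+ i.+1 * (e i.+1 * h (m - i.+1)).
Proof.
move=> m0; apply/eqP; rewrite -addr_eq0; apply/eqP.
rewrite -[RHS](eh m0) [in RHS]big_mkcond big_ord_recl /= expr0 e0 !mul1r subn0.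
by congr (_ + _); rewrite big_mkcond.
Qed.

(** The term [i = m] of [eh] is [e m] up to sign, so solving for it takes no division; the other
    terms contain only [e i] with [i < m]. *)
Lemma hspan_e m : (m <= k)%N -> hspan m (e m).
Proof.
elim/ltn_ind: m => m IH mk.
have [->|m0] := posnP m; first by rewrite e0; apply: hspan1.
have := eh m0; rewrite (bigD1 (Ordinal (mk : m < k.+1)%N)) //= subnn h0 mulr1.
move/eqP; rewrite addr_eq0 => /eqP em.
have -> : e m = (-1) ^+ m * ((-1) ^+ m * e m).
  by rewrite mulrA -exprD addnn -mul2n exprM sqrrN expr1n expr1n mul1r.
rewrite em mulrN mulr_signZ.
apply/lspanN/lspanZ/lspan_sum => i /andP[im ni].
rewrite mulr_signZ; apply: lspanZ.
have lim : (i < m)%N.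
  by rewrite ltn_neqAle im andbT; apply: contra ni => /eqP E; apply/eqP/val_inj.
rewrite -/(hspan m _) -[X in hspan X _](subnKC im); apply: hspanM; last exact: hspan_h.
by apply: IH lim _; apply: leq_trans im mk.
Qed.

(** A Jacobi-Trudi determinant, with [h] of a negative index read as 0. *)
Lemma det_h_eq0 (mu : 'I_k.+1 -> nat) : (forall i, 0 < mu i)%N ->
  \det (\matrix_(i, j < k.+1)
          if (i <= mu i + j)%N then h (mu i + j - i) else 0) = 0.
Proof.
move=> mu0; set M := \matrix_(_, _) _.
(* v is in the kernel of M, and its last entry is e 0 = 1. *)
pose v : 'cV[A]_k.+1 := \col_j ((-1) ^+ (k - j) * e (k - j)).
have Mv : M *m v = 0.
  apply/colP => i; rewrite !mxE.
  (* Row [i] of [M] times [v] is the relation [eh] at [mu i + k - i], summed in reverse order. *)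
  have m0 : (0 < mu i + k - i)%N by have := mu0 i; have := ltn_ord i; lia.
  rewrite -[RHS](eh m0) (reindex_inj rev_ord_inj) [RHS]big_mkcond.
  apply: eq_bigr => j _; rewrite !mxE /= !subSS.
  have jk : (j <= k)%N by rewrite -ltnS.
  have ik : (i <= k)%N by rewrite -ltnS.
  have -> : (i <= mu i + (k - j))%N = (j <= mu i + k - i)%N by lia.
  case: ifP => _; last by rewrite mul0r.
  rewrite subKn // mulrC -mulrA; congr (_ * (_ * h _)); lia.
have : (\det M)%:M *m v = 0 by rewrite -mul_adj_mx -mulmxA Mv mulmx0.
move/colP/(_ ord_max); rewrite mul_scalar_mx !mxE /= subnn expr0 e0 !mulr1.
by [].
Qed.

(** Measures how concentrated the parts are: straightening raises it, while [potential_leq] bounds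
    it for fixed size and sum, so straightening terminates. *)
Definition potential (B : nat) (nu : seq nat) : nat := (\sum_(x <- nu) B ^ x)%N.

Lemma potential_leq B nu : (0 < B)%N ->
  (potential B nu <= size nu * B ^ sumn nu)%N.
Proof.
move=> B0; elim: nu => [|x nu IH]; first by rewrite /potential big_nil.
rewrite /potential big_cons /= mulSn leq_add ?leq_pexp2l ?leq_addr //.
by apply: leq_trans IH _; rewrite leq_mul2l leq_pexp2l ?leq_addl // orbT.
Qed.

(* The first index moved by s is moved up, and raising that exponent by one   *)
(* outweighs all the later ones together.                                     *)
Lemma potential_perm (mu : 'I_k.+1 -> nat) (s : 'S_k.+1) :
    (forall i j : 'I_k.+1, i <= j -> mu j <= mu i)%N ->
    (forall i : 'I_k.+1, i <= mu i + s i)%N -> s != 1%g ->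
  (\sum_i k.+2 ^ mu i < \sum_i k.+2 ^ (mu i + s i - i))%N.
Proof.
move=> mu_dec s_ok s1.
have [i0 si0] : exists i, s i != i.
  apply/existsP; rewrite -negb_forall; apply: contra s1 => /forallP H.
  by apply/eqP/permP => i; rewrite perm1; apply/eqP.
have [i si min_i] := @arg_minnP _ i0 (fun i => s i != i) (@nat_of_ord _) si0.
have fixlt (j : 'I_k.+1) : (j < i)%N -> s j = j.
  by move=> ji; apply/eqP/negPn/negP => /min_i; rewrite leqNgt ji.
have isi : (i < s i)%N.
  rewrite ltn_neqAle eq_sym (inj_eq val_inj) si leqNgt /=; apply/negP => /[dup] /fixlt.
  by move/perm_inj => ->; rewrite ltnn.
rewrite [X in (X < _)%N](bigID (fun j : 'I_k.+1 => (j < i)%N)) /=.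
rewrite [X in (_ < X)%N](bigID (fun j : 'I_k.+1 => (j < i)%N)) /=.
rewrite -addnS leq_add //.
  by apply: leq_sum => j /fixlt->; rewrite addnK.
rewrite [X in (_ < X)%N](bigD1 i) /=; last by rewrite ltnn.
apply: (@leq_trans (k.+2 ^ (mu i).+1)); last first.
  apply: leq_trans (leq_addr _ _); rewrite leq_exp2l //.
  by move: isi; have := s_ok i; lia.
(* The base [k + 2] is chosen for this: at most [k + 1] terms remain, each at most [(k + 2) ^ mu i],
   so together they stay below [(k + 2) ^ (mu i + 1)]. *)
have : (\sum_(j < k.+1 | ~~ (j < i)) k.+2 ^ mu j <= k.+1 * k.+2 ^ mu i)%N.
  apply: leq_trans (_ : \sum_(j < k.+1) k.+2 ^ mu i <= _)%N.
    rewrite big_mkcond /=; apply: leq_sum => j _.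
    by case: ifP => // ji; rewrite leq_exp2l // mu_dec // leqNgt.
  by rewrite sum_nat_const card_ord.
move/leq_ltn_trans; apply; rewrite expnS ltn_pmul2r // expn_gt0 //.
Qed.

(** Expand the determinant of [det_h_eq0] on the first [k + 1] parts, all positive because [mu] is
    sorted. The identity permutation gives their product, and [potential_perm] applies to every
    other nonzero term. *)
Lemma straighten mu : sorted geq mu -> (k < size mu)%N ->
    (0 < nth 0 mu k)%N ->
  lspan (fun x => exists nu, [/\ size nu = size mu, sumn nu = sumn mu,
      (potential k.+2 mu < potential k.+2 nu)%N & x = hmon nu]) (hmon mu).
Proof.
move=> mu_s kmu muk; pose m (i : 'I_k.+1) := nth 0%N mu i.
have mu_split (T : Type) (idx : T) (op : Monoid.law idx) (F : nat -> T) :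
    \big[op/idx]_(x <- mu) F x =
    op (\big[op/idx]_(i < k.+1) F (m i)) (\big[op/idx]_(x <- drop k.+1 mu) F x).
  rewrite -[in LHS](cat_take_drop k.+1 mu) big_cat; congr (op _ _).
  rewrite (big_nth 0%N) size_take_min (minn_idPl kmu) big_mkord.
  by apply: eq_bigr => i _; rewrite nth_take.
have m_dec (i j : 'I_k.+1) : (i <= j)%N -> (m j <= m i)%N.
  move=> ij; apply: (sorted_leq_nth _ _ 0%N mu_s) ij => //.
  - by move=> x y z yx xz; apply: leq_trans xz yx.
  - by move=> x; apply: leqnn.
  - by rewrite inE; apply: leq_trans kmu.
  - by rewrite inE; apply: leq_trans kmu.
have m0 i : (0 < m i)%N.
  by apply: leq_trans muk (m_dec i ord_max _); rewrite /= -ltnS.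
have := det_h_eq0 m0; rewrite /determinant (bigD1 1%g) //= odd_perm1 expr0 mul1r.
under eq_bigr do rewrite perm1 mxE leq_addl addnK.
move/eqP; rewrite addr_eq0 => /eqP head.
rewrite {2}/hmon (mu_split _ _ *%R) /= head mulNr mulr_suml.
apply/lspanN/lspan_sum => s s1.
rewrite mulr_signZ -scalerAl; apply: lspanZ.
have [/forallP s_ok|] := boolP [forall i : 'I_k.+1, (i <= m i + s i)%N]; last first.
  rewrite negb_forall => /existsP[i /negPf im].
  by rewrite (bigD1 i) //= mxE im !mul0r; apply: lspan0.
apply: lspan_gen.
exists ([seq (m i + s i - i)%N | i <- enum 'I_k.+1] ++ drop k.+1 mu); split.
- by rewrite size_cat size_map size_enum_ord size_drop subnKC.
- rewrite sumn_cat !sumnE big_map big_enum /= (mu_split _ _ addn id) /=.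
  (* Adding the sum of all [i] undoes the truncated subtractions, and [s] only permutes the summands
     [s i]. *)
  congr addn; apply/eqP; rewrite -(eqn_add2r (\sum_(i < k.+1) i)) -big_split /=.
  under eq_bigr do rewrite subnK //.
  by rewrite big_split /= [X in (_ + X)%N == _](reindex_inj (@perm_inj _ s^-1)) /=;
     under [X in (_ + X)%N == _]eq_bigr do rewrite permKV.
- rewrite /potential big_cat /= big_map big_enum /=.
  rewrite (mu_split _ _ addn (expn k.+2)) /=.
  by rewrite ltn_add2r; apply: potential_perm.
- rewrite hmon_cat; congr (_ * _); rewrite /hmon big_map big_enum /=.
  by apply: eq_bigr => i _; rewrite mxE s_ok.
Qed.

(* The part of weight <= d of the ideal (h (N + 1), ..., h (N + k)). *)
Definition ideal_hspan (d : nat) : A -> Prop :=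
  lspan (fun x => exists nu (j : 'I_k),
    (sumn nu + (N + j.+1) <= d)%N /\ x = hmon nu * h (N + j.+1)).

Lemma ideal_hspanM d d' x y : hspan d x -> ideal_hspan d' y -> ideal_hspan (d + d') (x * y).
Proof.
apply: lspanM => u v [mu md ->] [nu [j [nd ->]]]; apply: lspan_gen.
exists (mu ++ nu), j; rewrite hmon_cat mulrA sumn_cat -addnA.
by rewrite leq_add.
Qed.

(** Up to [N + k] these are generators. Beyond, [eh_rec] involves only [h (m - i.+1)] with [i < k],
    whose index is smaller but still exceeds [N]. *)
Lemma ideal_hspan_h m : (N < m)%N -> ideal_hspan m (h m).
Proof.
elim/ltn_ind: m => m IH Nm; have [mNk|mNk] := leqP m (N + k).
  have jk : (m - N.+1 < k)%N by lia.
  apply: lspan_gen; exists [::], (Ordinal jk); rewrite /hmon big_nil mul1r /=.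
  by have -> : (N + (m - N.+1).+1)%N = m by lia.
rewrite eh_rec; last by lia.
apply/lspanN/lspan_sum => i im.
rewrite mulr_signZ; apply: lspanZ.
have ik := ltn_ord i.
rewrite -/(ideal_hspan m _) -[X in ideal_hspan X _](subnKC im); apply: ideal_hspanM.
  by apply: hspan_e.
by apply: IH; lia.
Qed.

Variable a : 'I_k -> A.
Hypothesis a_small : forall i : 'I_k, hspan (N + i) (a i).

Let g (i : 'I_k) := h (N + i.+1) - a i.

Definition fspan (d : nat) : A -> Prop :=
  lspan (fun x => exists la (c : 'I_k -> nat), [/\ in_box N k la,
    (sumn la + \sum_i c i * (N + i.+1) <= d)%N &
    x = hmon la * \prod_i g i ^+ c i]).

Lemma fspanW d d' x : (d <= d')%N -> fspan d x -> fspan d' x.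
Proof.
move=> dd'; apply: lspan_trans => y [la [c [la_box lac ->]]].
by apply: lspan_gen; exists la, c; split=> //; apply: leq_trans dd'.
Qed.

(** The conclusion records [0 < c j]; this is how [box_family_free] knows that elements of the ideal
    involve only members with a nonzero exponent. *)
Lemma fspan_gM d (j : 'I_k) x : fspan d x ->
  lspan (fun y => exists la (c : 'I_k -> nat), [/\ in_box N k la,
    (sumn la + \sum_i c i * (N + i.+1) <= d + (N + j.+1))%N,
    y = hmon la * \prod_i g i ^+ c i & (0 < c j)%N]) (x * g j).
Proof.
move=> fx; apply: (lspanM _ fx (lspan_gen (erefl (g j)))).
move=> _ _ [la [c [la_box lac ->]]] <-; apply: lspan_gen.
exists la, (fun i => c i + (i == j))%N; split; rewrite ?eqxx ?addn1 //.
  rewrite (eq_bigr (fun i => c i * (N + i.+1) + (i == j) * (N + i.+1))%N); last first.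
    by move=> i _; rewrite mulnDl.
  rewrite big_split /= addnA.
  have -> : (\sum_(i < k) (i == j) * (N + i.+1) = N + j.+1)%N.
    by rewrite (bigD1 j) //= eqxx mul1n big1 ?addn0 // => i /negPf->.
  by rewrite leq_add2r.
under [in RHS]eq_bigr do rewrite exprD.
rewrite big_split /= mulrA; congr (_ * _).
by rewrite (bigD1 j) //= eqxx expr1 big1 ?mulr1 // => i /negPf->.
Qed.

(** Two nested inductions: on the weight [d], for replacing [h (N + j.+1)] by [g j + a j], and on
    the room left for the potential, for straightening lists with more than [k] nonzero parts. *)
Lemma hspan_fspan d x : hspan d x -> fspan d x.
Proof.
elim/ltn_ind: d x => d IHd x.
(* Both the cofactor of [g j] and the product with [a j] have weight below [d], so the outer
   induction applies. *)
have IHj y : ideal_hspan d y -> fspan d y.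
  apply: lspan_trans => _ [nu [j [nud ->]]].
  rewrite -(subrK (a j) (h _)) -/(g j) mulrDr; apply: lspanD.
    have : fspan (sumn nu) (hmon nu).
      by apply: IHd; [lia | apply: lspan_gen; exists nu].
    move/(fspan_gM j); apply: lspan_trans => _ [la [c [la_box lac -> _]]].
    by apply: lspan_gen; exists la, c; split=> //; apply: leq_trans nud.
  apply: (@fspanW (sumn nu + (N + j))); first by lia.
  apply: IHd; first by lia.
  by apply: hspanM => //; apply: lspan_gen; exists nu.
apply: lspan_trans => {x} _ [nu nud ->]; rewrite -/(fspan d (hmon nu)).
have [p] := ubnP (size nu * k.+2 ^ sumn nu - potential k.+2 nu)%N.
elim: p nu nud => // p IHp nu nud nup.
have [/hasP[m m_nu Nm]|/hasPn nu_le] := boolP (has (ltn N) nu).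
  apply: IHj; rewrite (hmon_perm (perm_to_rem m_nu)) /hmon big_cons mulrC.
  rewrite -/(hmon (rem m nu)).
  have nud' : (sumn (rem m nu) + m <= d)%N.
    by move: nud; rewrite !sumnE (perm_big _ (perm_to_rem m_nu)) big_cons addnC.
  have : ideal_hspan (sumn (rem m nu) + m) (hmon (rem m nu) * h m).
    apply: ideal_hspanM (ideal_hspan_h Nm).
    by apply: lspan_gen; exists (rem m nu).
  apply: lspan_trans => y [mu [j [muj ->]]]; apply: lspan_gen.
  by exists mu, j; split=> //; apply: leq_trans nud'.
pose mu := sort geq nu.
have mu_s : sorted geq mu by apply: sort_sorted => x y; apply: leq_total.
have nu_mu : perm_eq nu mu by rewrite perm_sym; apply/permPl/perm_sort.
have sum_mu : sumn mu = sumn nu by rewrite !sumnE (perm_big _ nu_mu).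
have pot_mu : potential k.+2 mu = potential k.+2 nu by rewrite /potential (perm_big _ nu_mu).
have size_mu : size mu = size nu by rewrite (perm_size nu_mu).
rewrite (hmon_perm nu_mu).
(* With the default value 0, [nth 0 mu k = 0] says that the sorted list [mu] has at most [k] nonzero
   entries, whatever its length. *)
have [muk|] := posnP (nth 0%N mu k); last first.
  move=> muk; have kmu : (k < size mu)%N.
    by rewrite ltnNge; apply: contraL muk => kmu; rewrite nth_default.
  apply: lspan_trans (straighten mu_s kmu muk) => _ [nu' [sz sm pt ->]].
  apply: IHp; rewrite ?sm ?sum_mu // sz size_mu.
  have := @potential_leq k.+2 nu' isT; rewrite sm sz sum_mu size_mu.
  by move: nup pt; rewrite pot_mu; lia.
(* Deleting the zeros leaves a partition in the box and preserves [hmon], as [h 0 = 1]; all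
   exponents of the [g i] are 0. *)
apply: lspan_gen; exists [seq x <- mu | 0 < x]%N, (fun=> 0%N); split.
- apply/and3P; split.
  + rewrite /is_partition mem_filter ltnn /= andbT; apply: sorted_filter mu_s.
    by move=> x y z yx xz; apply: leq_trans xz yx.
  + rewrite size_filter -[mu](cat_take_drop k) count_cat.
    rewrite -[leqRHS]addn0 leq_add //.
      by apply: leq_trans (count_size _ _) _; rewrite size_take_min geq_minl.
    rewrite leqNgt -has_count; apply/hasP => -[x /(nthP 0%N)[i]].
    rewrite size_drop nth_drop => i_sz <-; apply/negP; rewrite -leqNgt -{}[leqRHS]muk.
    have geq_trans : transitive geq by move=> b c d' cb bd; apply: leq_trans bd cb.
    apply: (sorted_leq_nth geq_trans leqnn 0%N mu_s); rewrite ?inE ?leq_addr //;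
      move: i_sz; rewrite ltn_subRL //.
    by apply: leq_trans; rewrite ltnS leq_addr.
  + apply/allP => x; rewrite mem_filter -(perm_mem nu_mu) => /andP[_ /nu_le].
    by rewrite -leqNgt.
- under eq_bigr do rewrite mul0n.
  rewrite big1_eq addn0; apply: leq_trans nud; rewrite -sum_mu !sumnE big_filter.
  by rewrite big_mkcond; apply: leq_sum => x _; case: ifP.
- rewrite [X in _ * X]big1 ?mulr1; last by move=> i _; rewrite expr0.
  rewrite /hmon big_filter [in RHS]big_mkcond; apply: eq_bigr => x _.
  by case: posnP => // ->; rewrite h0.
Qed.

End Straightening.

(** * Counting *)

(** Recursion on whether the largest part equals [N]: if so, removing it lowers [k]; otherwise the
    bound [N] drops. The inner [fix] makes both calls structural. *)
Fixpoint box_seq (N k : nat) : seq (seq nat) :=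
  if N is N'.+1 then
    (fix box_row (k : nat) : seq (seq nat) :=
       if k is k'.+1 then map (cons N) (box_row k') ++ box_seq N' k
       else [:: [::]]) k
  else [:: [::]].

Lemma box_seqS N k :
  box_seq N.+1 k.+1 = map (cons N.+1) (box_seq N.+1 k) ++ box_seq N k.+1.
Proof. by []. Qed.

Lemma in_box_cons N k x la : in_box N k (x :: la) =
  [&& (0 < x)%N, (x <= N)%N, (0 < k)%N & in_box x k.-1 la].
Proof.
have geq_trans : transitive geq by move=> a b c ba cb; apply: leq_trans cb ba.
rewrite /in_box /is_partition /= inE negb_or lt0n eq_sym (path_sortedE geq_trans).
case: k => [|k]; first by rewrite !ltn0 !(andbF, andFb).
rewrite ltnS /=; apply/idP/idP.
  by case/andP=> /andP[/andP[-> ->] /andP[-> ->]] /andP[-> /andP[-> _]].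
case/and4P=> -> xN /andP[-> ->] /andP[-> la_x].
rewrite (la_x : all (geq x) la) xN !andbT /=.
by apply/allP => y /(allP la_x) /leq_trans; apply.
Qed.

Lemma mem_box_seq N k la : (la \in box_seq N k) = in_box N k la.
Proof.
elim: N k la => [|N IHN] k la.
  case: la => [|x la]; first by rewrite inE.
  by rewrite in_box_cons inE /=; case: x.
elim: k la => [|k IHk] la.
  by case: la => [|x la] //; rewrite in_box_cons !andbF.
rewrite box_seqS mem_cat IHN; case: la => [|x la].
  by rewrite orbC.
rewrite !in_box_cons /= [(x <= N.+1)%N]leq_eqVlt ltnS.
have -> : (x :: la \in map (cons N.+1) (box_seq N.+1 k)) = (x == N.+1) && in_box N.+1 k la.
  rewrite -IHk; apply/mapP/andP => [[la' la'_box [-> ->]]|[/eqP-> la_box]].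
    by rewrite eqxx.
  by exists la.
by case: eqVneq => [->|_] //=; rewrite ltnn orbF.
Qed.

Lemma uniq_box_seq N k : uniq (box_seq N k).
Proof.
elim: N k => [|N IHN] // k; elim: k => [|k IHk] //.
rewrite box_seqS cat_uniq IHN map_inj_uniq ?IHk => [|x y [] //].
rewrite andbT /=; apply/hasPn => la; rewrite mem_box_seq => la_box.
apply/mapP => -[la' _ la_E]; move: la_box; rewrite la_E in_box_cons.
by rewrite ltnn andbF.
Qed.

Lemma in_box_parts k n (la : box_partition k n) : in_box (n - k) k (parts la).
Proof.
case: la => la la_part; rewrite /in_box la_part /parts /= size_map size_bseq /=.
by apply/allP => _ /mapP[i _ ->]; rewrite -ltnS.
Qed.

Lemma parts_inj k n : injective (@parts k n).
Proof.
move=> x y /(inj_map val_inj) xy; apply: val_inj; exact: val_inj.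
Qed.

Lemma in_box_partsP k n la : in_box (n - k) k la -> exists mu : box_partition k n, la = parts mu.
Proof.
case/and3P=> la_part la_size /allP la_le.
pose s : seq 'I_(n - k).+1 := map inord la.
have val_s : map val s = la.
  rewrite -map_comp -[RHS]map_id; apply/eq_in_map => x /la_le x_le /=.
  by rewrite inordK.
have s_size : (size s <= k)%N by rewrite size_map.
have s_part : is_partition (map val (Bseq s_size)) by rewrite /= val_s.
by exists (exist _ (Bseq s_size) s_part).
Qed.

Lemma perm_box_seq k n :
  perm_eq [seq parts la | la : box_partition k n] (box_seq (n - k) k).
Proof.
apply: uniq_perm; first by rewrite map_inj_uniq ?enum_uniq //; apply: parts_inj.
  exact: uniq_box_seq.
move=> la; rewrite mem_box_seq; apply/imageP/idP => [[mu _ ->]|].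
  exact: in_box_parts.
by case/in_box_partsP=> mu ->; exists mu.
Qed.

(** The Gaussian binomial formula with denominators cleared; the induction step is the q-Pascal rule
    coming from the recursion of [box_seq]. *)
Lemma q_binomial N k :
  (\sum_(la <- box_seq N k) 'X^(sumn la)) * \prod_(i < k) (1 - 'X^(i.+1))
  = \prod_(i < k) (1 - 'X^(N + i.+1)) :> {poly int}.
Proof.
elim: N k => [|N IHN] k; first by rewrite big_seq1 expr0 mul1r.
elim: k => [|k IHk]; first by rewrite big_seq1 !big_ord0 expr0 mulr1.
rewrite box_seqS big_cat big_map /= mulrDl IHN big_ord_recr /=.
rewrite (eq_bigr (fun la => 'X^(N.+1) * 'X^(sumn la))) => [|la _]; last first.
  by rewrite exprD.
rewrite -mulr_sumr -!mulrA [X in _ * X]mulrA IHk big_ord_recl /=.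
have -> : \prod_(i < k) (1 - 'X^(N + (bump 0 i).+1))
    = \prod_(i < k) (1 - 'X^(N.+1 + i.+1)) :> {poly int}.
  by apply: eq_bigr => i _; rewrite /bump add1n -addSnnS.
rewrite [RHS]big_ord_recr /= addn1.
have -> : 'X^(N.+1 + k.+1) = 'X^(N.+1) * 'X^(k.+1) :> {poly int} by rewrite exprD.
by ring.
Qed.

(** Each truncated geometric series telescopes against [1 - 'X^(w i)] to [1 - 'X^(D * w i)], and
    [w i > 0] makes the error a multiple of ['X^D]. *)
Lemma exp_series (w : nat -> nat) k D : (forall i, 0 < w i)%N ->
  exists r : {poly int},
    (\prod_(i < k) (1 - 'X^(w i)))
      * (\sum_(c : {ffun 'I_k -> 'I_D}) 'X^(\sum_i c i * w i))
    = 1 + 'X^D * r.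
Proof.
move=> w0.
have -> : \sum_(c : {ffun 'I_k -> 'I_D}) 'X^(\sum_i c i * w i)
    = \prod_(i < k) \sum_(j < D) 'X^(j * w i) :> {poly int}.
  rewrite bigA_distr_bigA /=; apply: eq_bigr => c _.
  by rewrite expr_sum.
rewrite -big_split /=; elim: k => [|k [r IHr]].
  by exists 0; rewrite big_ord0 mulr0 addr0.
rewrite big_ord_recr /= IHr.
have -> : (1 - 'X^(w k)) * (\sum_(j < D) 'X^(j * w k)) = 1 - 'X^D * 'X^(w k * D - D) :> {poly int}.
  rewrite -exprD subnKC ?leq_pmull // exprM -[RHS]opprB subrX1 -mulNr opprB.
  by congr (_ * _); apply: eq_bigr => j _; rewrite mulnC exprM.
by exists (r - 'X^(w k * D - D) - 'X^D * r * 'X^(w k * D - D)); ring.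
Qed.

(** [U] is invertible modulo ['X^D]: coefficient [j] of [U * p] is that of [p] plus multiples of
    earlier coefficients of [p], which vanish by induction. *)
Lemma coef_mul_small (U p r : {poly int}) D :
  U`_0 = 1 -> U * p = 'X^D * r -> forall j, (j < D)%N -> p`_j = 0.
Proof.
move=> U0 Up; elim/ltn_ind => j IHj jD.
have := congr1 (fun q : {poly int} => q`_j) Up.
rewrite coefXnM jD coefM big_ord_recl U0 mul1r subn0 big1 ?addr0 // => i _.
have ij := ltn_ord i; rewrite IHj ?mulr0 //= /bump /=; lia.
Qed.

(** The first [D] coefficients of a generating function add up to the number of elements of weight
    below [D], and an integer determines that number. *)
Lemma card_weight_lt (T T' : finType) (w : T -> nat) (w' : T' -> nat) D :
    (forall j, (j < D)%N ->
       (\sum_t 'X^(w t) : {poly int})`_j = (\sum_t 'X^(w' t) : {poly int})`_j) ->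
  #|[pred t | w t < D]%N| = #|[pred t | w' t < D]%N|.
Proof.
have cardE (S : finType) (v : S -> nat) :
    (#|[pred t | v t < D]%N|%:R : int) = \sum_(j < D) (\sum_t 'X^(v t) : {poly int})`_j.
  rewrite -sum1_card big_mkcond natr_sum /=.
  under [RHS]eq_bigr do rewrite coef_sum.
  rewrite exchange_big; apply: eq_bigr => t _; rewrite inE.
  under eq_bigr do rewrite coefXn.
  case: ltnP => vD; last first.
    by rewrite big1 // => j _; rewrite ltn_eqF // (leq_trans _ vD).
  rewrite (bigD1 (Ordinal vD)) //= eqxx big1 ?addr0 // => j.
  by rewrite -val_eqE /= => /negPf->.
move=> H; have : (#|[pred t | w t < D]%N|%:R : int) = #|[pred t | w' t < D]%N|%:R.
  by rewrite !cardE; apply: eq_bigr => j _; apply: H.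
by move/eqP; rewrite Num.Theory.eqr_nat => /eqP.
Qed.

(** Modulo ['X^D] both generating functions invert the product of the [1 - 'X^(i.+1)]: by
    [q_binomial] the box supplies the numerator that cancels the series of the exponents [x.2]. *)
Lemma card_box_weight k n D :
  #|[pred x : box_partition k n * {ffun 'I_k -> 'I_D} |
      sumn (parts x.1) + \sum_i x.2 i * (n - k + i.+1) < D]%N|
  = #|[pred c : {ffun 'I_k -> 'I_D} | \sum_i c i * i.+1 < D]%N|.
Proof.
apply: card_weight_lt => j jD; apply/eqP; rewrite -subr_eq0 -coefB; apply/eqP.
have [r1 E1] := @exp_series (fun i => n - k + i.+1)%N k D (fun i => ltn_addl _ (ltn0Sn i)).
have [r2 E2] := @exp_series (fun i => i.+1)%N k D (fun i => ltn0Sn i).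
apply: (@coef_mul_small (\prod_(i < k) (1 - 'X^(i.+1))) _ (r1 - r2) D) jD.
  rewrite -horner_coef0 horner_prod big1 // => i _.
  by rewrite !hornerE expr0n subr0.
rewrite mulrBr E2.
have -> : \sum_(x : box_partition k n * {ffun 'I_k -> 'I_D})
       'X^(sumn (parts x.1) + \sum_i x.2 i * (n - k + i.+1)) =
   (\sum_(la <- box_seq (n - k) k) 'X^(sumn la)) *
   \sum_(c : {ffun 'I_k -> 'I_D}) 'X^(\sum_i c i * (n - k + i.+1)) :> {poly int}.
  rewrite -(perm_big _ (perm_box_seq k n)) big_map big_enum /= mulr_suml.
  under [RHS]eq_bigr do rewrite mulr_sumr.
  by rewrite pair_big; apply: eq_bigr => x _; rewrite exprD.
by rewrite mulrC mulrAC q_binomial E1; ring.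
Qed.

(** * Elementary and complete homogeneous symmetric polynomials *)

Section SymmetricPolynomials.
Variables (R : comNzRingType) (k : nat).
Implicit Types (p q : {mpoly R[k]}).

Lemma mcoeffXM (t m : 'X_{1..k}) p :
  ('X_[t] * p)@_m = if (t <= m)%MM then p@_(m - t) else 0.
Proof.
case: ifP => [tm|tm]; first by rewrite mulrC -(mcoeffMX p t (m - t)%MM) addmC submK.
rewrite [p]mpolyE mulr_sumr raddf_sum /= big1 // => u _.
rewrite -scalerAr mcoeffZ -mpolyXD mcoeffX; case: eqP => [E|_]; last by rewrite mulr0.
by rewrite -E lem_addr in tm.
Qed.

Lemma msizeM_le_pred p q d d' :
  (msize p <= d.+1)%N -> (msize q <= d'.+1)%N -> (msize (p * q) <= (d + d').+1)%N.
Proof.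
move=> pd qd; rewrite msizeE; apply/bigmax_leqP_seq => m /msuppM_le.
case/allpairsP=> -[m1 m2] /= [m1p m2q -> _]; rewrite mdegD ltnS leq_add //.
  by rewrite -ltnS; apply: leq_trans (msize_mdeg_lt m1p) pd.
by rewrite -ltnS; apply: leq_trans (msize_mdeg_lt m2q) qd.
Qed.

Lemma msize_hpoly d : (msize (hpoly k R d) <= d.+1)%N.
Proof.
rewrite msizeE; apply/bigmax_leqP_seq => m; rewrite mcoeff_msupp mcoeff_hpoly => md _.
by move: md; have [->|_] := eqVneq (mdeg m) d; rewrite ?ltnSn ?eqxx.
Qed.

Lemma hpoly0 : hpoly k R 0 = 1.
Proof. by apply/mpolyP => m; rewrite mcoeff_hpoly mcoeff1 mdeg_eq0. Qed.

(* The coefficient of 'X_[u] is the sum of (-1)^|T| over the subsets T of the *)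
(* support of u, restricted to deg u = m.                                     *)
Lemma mesym_hpoly m : (0 < m)%N ->
  \sum_(i < k.+1 | (i <= m)%N) (-1) ^+ i * (mesym k R i * hpoly k R (m - i)) = 0.
Proof.
move=> m0; apply/mpolyP => u; rewrite mcoeff0 raddf_sum /=.
pose sub (T : {set 'I_k}) := [forall i in T, 0 < u i]%N.
have le_sub (T : {set 'I_k}) : (mesym1 T <= u)%MM = sub T.
  apply/mnm_lepP/forall_inP => [H i iT|H i]; first by have := H i; rewrite mnmE iT.
  by rewrite mnmE; case: (boolP (i \in T)) => // /H.
have coefE (i : 'I_k.+1) : (i <= m)%N ->
    ((-1) ^+ i * (mesym k R i * hpoly k R (m - i)))@_u
    = \sum_(T : {set 'I_k} | #|T| == i) (-1) ^+ #|T| * (sub T && (mdeg u == m))%:R.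
  move=> im; rewrite mulr_signZ mcoeffZ mesymE mulr_suml raddf_sum mulr_sumr /=.
  apply: eq_bigr => T /eqP Ti; rewrite Ti mcoeffXM le_sub; congr (_ * _).
  case: ifP => // sT; rewrite mcoeff_hpoly /= -Ti; congr (_%:R); congr nat_of_bool.
  have uT : (mesym1 T <= u)%MM by rewrite le_sub.
  rewrite -{2}(submK uT) mdegD mdeg_mesym1 -(eqn_add2r #|T|) subnK //.
  by rewrite Ti.
have [um|um] := eqVneq (mdeg u) m; last first.
  rewrite big1 // => i im; rewrite coefE // big1 // => T _.
  by rewrite (negPf um) andbF mulr0.
rewrite um eqxx in coefE.
transitivity (\sum_(T : {set 'I_k}) (-1) ^+ #|T| * (sub T)%:R : R).
  rewrite (partition_big (fun T : {set 'I_k} => inord #|T| : 'I_k.+1) predT) //=.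
  rewrite big_mkcond; apply: eq_bigr => i _.
  have cardT (T : {set 'I_k}) : (inord #|T| == i :> 'I_k.+1) = (#|T| == i).
    by rewrite -val_eqE /= inordK // ltnS (leq_trans (max_card _)) ?card_ord.
  case: ifP => im.
    by rewrite coefE //; apply: eq_big => T; rewrite ?cardT // andbT.
  rewrite big1 // => T; rewrite cardT => /eqP Ti.
  rewrite -le_sub; case: (boolP (_ <= u)%MM) => [uT|]; last by rewrite mulr0.
  move/negP: im; case; rewrite -Ti -um -(submK uT) mdegD mdeg_mesym1.
  exact: leq_addl.
have [i ui] : exists i, (0 < u i)%N.
  apply/existsP; apply: contraTT m0; rewrite negb_exists => /forallP u0.
  by rewrite -um mdegE big1 // => i _; have := u0 i; rewrite lt0n negbK => /eqP.
(* Expanded over subsets, this product is the alternating sum; its factor at an index [i] of the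
   support of [u] is [-1 + 1]. *)
transitivity (\prod_i (- (0 < u i)%N%:R + 1) : R); last first.
  by rewrite (bigD1 i) //= ui addNr mul0r.
rewrite bigA_distr; apply: eq_bigr => T _; rewrite -big_mkcond /= prodrN.
congr (_ * _); rewrite /sub.
have [/forall_inP H|] := boolP [forall i in T, 0 < u i]%N.
  by rewrite big1 // => j /H->.
rewrite negb_forall => /existsP[j]; rewrite negb_imply => /andP[jT uj].
by rewrite (bigD1 j) //= (negPf uj) mul0r.
Qed.

HB.instance Definition _ := GRing.RMorphism.copy (@sympoly_val k R)
  (val : sympoly k R -> {mpoly R[k]}).
HB.instance Definition _ := GRing.Linear.copy (@sympoly_val k R)
  (val : sympoly k R -> {mpoly R[k]}).

Definition elemsym (i : nat) : {sympoly R[k]} := SymPoly (mesym_sym k R i).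

Local Notation A := {sympoly R[k]}.
Local Notation h := (hsym k R).

Lemma hsym0 : h 0 = 1.
Proof. by apply: val_inj; apply: hpoly0. Qed.

Lemma elemsym0 : elemsym 0 = 1.
Proof. by apply: val_inj; apply: mesym0E. Qed.

Lemma elemsym_hsym m : (0 < m)%N ->
  \sum_(i < k.+1 | (i <= m)%N) (-1) ^+ i * (elemsym i * h (m - i)) = 0.
Proof.
move=> m0; apply: val_inj; rewrite raddf_sum /= -[RHS](mesym_hpoly m0).
by apply: eq_bigr => i _; rewrite rmorphXn rmorphN1.
Qed.

Lemma msize_hspan d (x : A) : hspan h d x -> (msize (sympoly_val x) <= d.+1)%N.
Proof.
have hmon_le nu : (msize (sympoly_val (hmon h nu)) <= (sumn nu).+1)%N.
  elim: nu => [|b nu IH]; first by rewrite /hmon big_nil [sympoly_val _]rmorph1 msize1.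
  rewrite /hmon big_cons [sympoly_val _]rmorphM /=.
  by apply: msizeM_le_pred IH; apply: msize_hpoly.
elim=> [|c y z [nu nud ->] _ IH]; first by rewrite [sympoly_val _]raddf0 msize0.
rewrite [sympoly_val _]raddfD /= (leq_trans (msizeD_le _ _)) // geq_max IH andbT.
rewrite (leq_trans (msizeZ_le _ _)) //.
by apply: leq_trans (hmon_le nu) _.
Qed.

Definition emon (c : 'I_k -> nat) : A := \prod_(i < k) elemsym i.+1 ^+ c i.

Lemma val_emon (m : 'X_{1..k}) :
  sympoly_val (emon m) = 'X_[m] \mPo [tuple mesym k R i.+1 | i < k].
Proof.
rewrite comp_mpolyX [LHS]rmorph_prod /=; apply: eq_bigr => i _.
by rewrite rmorphXn /= tnth_mktuple.
Qed.

(** The fundamental theorem with its weight bound: [mnmwgt m] is the degree of [emon m], and no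
    monomial that occurs exceeds the degree of [x]. *)
Lemma sym_emon_span D (x : A) : (msize (sympoly_val x) <= D)%N ->
  lspan (fun y => exists2 m : 'X_{1..k}, (mnmwgt m < D)%N & y = emon m) x.
Proof.
move=> xD; have [t [tx tw]] := sym_fundamental (sympolyP x).
have -> : x = \sum_(m <- msupp t) t@_m *: emon m.
  apply: val_inj; rewrite [LHS]/= -tx comp_mpolyEX [RHS]raddf_sum /=.
  by apply: eq_bigr => m _; rewrite val_emon.
rewrite big_seq; apply: lspan_sum => m mt; apply/lspanZ/lspan_gen; exists m => //.
by apply: leq_trans xD; apply: leq_trans tw; apply: mmeasure_mnm_lt mt.
Qed.

Lemma hspan_emon c : hspan h (\sum_(i < k) c i * i.+1) (emon c).
Proof.
apply: hspan_prod => i; apply: hspanX.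
by apply: (hspan_e hsym0 elemsym0 elemsym_hsym); apply: ltn_ord.
Qed.

(** With [msize_hspan], this identifies [hspan h d] with the symmetric polynomials of degree at most
    [d]. The [emon] monomials serve as the intermediate family. *)
Lemma hspan_msize d (x : A) : (msize (sympoly_val x) <= d.+1)%N -> hspan h d x.
Proof.
move/sym_emon_span; apply: lspan_trans => _ [m md ->].
by apply: (hspanW _ (hspan_emon m)); rewrite -ltnS.
Qed.

Lemma emon_free D (P : pred {ffun 'I_k -> 'I_D}) :
  free_family (fun c : {c | P c} => emon (fun i => val c i)).
Proof.
move=> a a0; pose mon (c : {c | P c}) : 'X_{1..k} := [multinom (val c i : nat) | i < k].
have mon_inj : injective mon.
  move=> c c' /mnmP E; apply/val_inj/ffunP => i; apply: val_inj.
  by have := E i; rewrite !mnmE.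
have : \sum_c a c *: 'X_[mon c] = 0 :> {mpoly R[k]}.
  apply: msym_fundamental_un0; rewrite raddf_sum /=.
  transitivity (sympoly_val (\sum_c a c *: emon (fun i => val c i))).
    rewrite [RHS]raddf_sum /=; apply: eq_bigr => c _; rewrite !linearZ /= -val_emon.
    by congr (_ *: sympoly_val _); apply: eq_bigr => i _; rewrite mnmE.
  by rewrite a0.
move=> t0 c; have := congr1 (mcoeff (mon c)) t0.
rewrite raddf_sum mcoeff0 /= (bigD1 c) //= mcoeffZ mcoeffX eqxx mulr1 big1 ?addr0 //.
by move=> c' c'c; rewrite mcoeffZ mcoeffX (inj_eq mon_inj) (negPf c'c) mulr0.
Qed.

End SymmetricPolynomials.

(** * The quotient *)

Section IdealQuotient.
Variables (R : comNzRingType) (A : comAlgType R) (m : nat) (g : 'I_m -> A).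
Local Notation Q := (ideal_gen_quot g).

Lemma pi_ideal_gen_eq0 (x : A) : \pi_Q x = 0 <-> x \in ideal_gen g.
Proof.
have pi0 : \pi_Q 0 = 0 by apply: (addrI (\pi_Q 0)); rewrite -pi_addq !addr0.
by rewrite -pi0 -[x in x \in _]subr0 Quotient.idealrBE; split=> /eqP.
Qed.

Lemma pi_ideal_genZ a : {morph \pi_Q : x / a *: x}.
Proof. exact: pi_scale. Qed.

Lemma pi_ideal_gen_sum (I : finType) (c : I -> R) (u : I -> A) :
  \pi_Q (\sum_i c i *: u i) = \sum_i c i *: \pi_Q (u i).
Proof.
elim/big_rec2: _ => [|i y x _ <-]; first by apply/pi_ideal_gen_eq0/rpred0.
by rewrite pi_addq pi_ideal_genZ.
Qed.

Lemma gen_ideal_gen i : g i \in ideal_gen g.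
Proof.
apply/asboolP; exists (fun j => (j == i)%:R).
by rewrite (bigD1 i) //= eqxx mul1r big1 ?addr0 // => j /negPf->; rewrite mul0r.
Qed.

End IdealQuotient.

(** * The deformed family and the basis of the quotient *)

Section DeformedBasis.
Variables (R : comNzRingType) (k n : nat) (a : 'I_k -> {sympoly R[k]}).
Hypothesis a_small :
  forall i : 'I_k, (msize (sympoly_val (a i)) <= n - k + i.+1)%N.

Local Notation A := {sympoly R[k]}.
Local Notation h := (hsym k R).
Local Notation N := (n - k)%N.
Local Notation g := (fun i : 'I_k => h (N + i.+1) - a i).

Lemma hspan_a (i : 'I_k) : hspan h (N + i) (a i).
Proof. by apply: hspan_msize; rewrite -addnS. Qed.

Lemma hspan_g (i : 'I_k) : hspan h (N + i.+1) (h (N + i.+1) - a i).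
Proof.
apply: lspanD; first exact: hspan_h.
by apply/lspanN/(hspanW _ (hspan_a i)); rewrite leq_add2l.
Qed.

Lemma fspan_full (x : A) : exists d, fspan N h a d x.
Proof.
exists (msize (sympoly_val x)).
apply: (hspan_fspan (hsym0 R k) (elemsym0 R k) (@elemsym_hsym R k) hspan_a).
by apply: hspan_msize.
Qed.

Definition fmon D (x : box_partition k n * {ffun 'I_k -> 'I_D}) : A :=
  hmon h (parts x.1) * \prod_(i < k) (h (N + i.+1) - a i) ^+ x.2 i.

Definition fweight D (x : box_partition k n * {ffun 'I_k -> 'I_D}) : nat :=
  (sumn (parts x.1) + \sum_(i < k) x.2 i * (N + i.+1))%N.

Local Notation findex D :=
  {x : box_partition k n * {ffun 'I_k -> 'I_D} | (fweight x < D)%N}.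

(** Each exponent is at most the weight, since [N + i.+1 > 0]; hence bounding exponents by [D] loses
    no member of weight below [D]. *)
Lemma fmon_index D la (c : 'I_k -> nat) :
    in_box N k la -> (sumn la + \sum_(i < k) c i * (N + i.+1) < D)%N ->
  exists2 x : findex D,
    forall i, (val x).2 i = c i :> nat &
    hmon h la * \prod_(i < k) (h (N + i.+1) - a i) ^+ c i = fmon (val x).
Proof.
move=> /in_box_partsP[mu ->] wD.
have cD i : (c i < D)%N.
  apply: leq_ltn_trans wD; apply: leq_trans (leq_addl _ _).
  by rewrite (bigD1 i) //= addnS mulnS -addnA leq_addr.
pose x := (mu, [ffun i => Ordinal (cD i)]).
have xD : (fweight x < D)%N.
  by rewrite /fweight /=; under eq_bigr do rewrite ffunE.
exists (exist _ x xD) => [i|]; first by rewrite /= ffunE.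
by rewrite /fmon /=; congr (_ * _); apply: eq_bigr => i _; rewrite ffunE.
Qed.

(** The comparison family is that of the [emon] monomials of weight below [D], free and equally
    numerous by [card_box_weight]; each family lies in the span of the other. *)
Lemma fmon_free D :
  free_family (fun x : findex D => fmon (val x)).
Proof.
apply: (@spanning_free _ _ _ {c : {ffun 'I_k -> 'I_D} | \sum_i c i * i.+1 < D}%N
  _ (fun c => emon R (fun i => val c i))).
- by rewrite !card_sig; apply: card_box_weight.
- exact: emon_free.
- case=> x xD.
  have x_span : hspan h (fweight x) (fmon x).
    apply: hspanM; first by apply: lspan_gen; exists (parts x.1).
    by apply: hspan_prod => i; apply/hspanX/hspan_g.
  have := sym_emon_span (leq_trans (msize_hspan x_span) xD).
  case/(@lspan_family _ _ _ {c : {ffun 'I_k -> 'I_D} | \sum_i c i * i.+1 < D}%N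
    (fun c => emon R (fun i => val c i)) predT) => [_ [m mD ->]|c _ ->]; last by exists c.
  have miD i : (m i < D)%N.
    apply: leq_ltn_trans mD; rewrite /mnmwgt (bigD1 i) //=.
    by rewrite mulnS -addnA leq_addr.
  pose c : {ffun 'I_k -> 'I_D} := [ffun i => Ordinal (miD i)].
  have cD : (\sum_i c i * i.+1 < D)%N by under eq_bigr do rewrite ffunE.
  exists (exist _ c cD) => //; apply: eq_bigr => i _.
  by rewrite /= ffunE.
- case=> c cD.
  have := hspan_fspan (hsym0 R k) (elemsym0 R k) (@elemsym_hsym R k) hspan_a
            (hspan_emon R (fun i => c i)).
  case/(@lspan_family _ _ _ (findex D)
    (fun x => fmon (val x)) predT) => [_ [la [c' [la_box lac ->]]]|b _ ->]; last by exists b.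
  by have [x _ ->] := fmon_index la_box (leq_ltn_trans lac cD); exists x.
Qed.

(** A relation in the quotient equates a combination of the [hsym_part] with an element of the
    ideal. The latter expands into members with a nonzero exponent, so freeness of the whole family
    separates the two sides. *)
Lemma box_family_free :
  free_family (fun la : box_partition k n =>
    \pi_(ideal_gen_quot g) (hsym_part k R (parts la))).
Proof.
move=> c; rewrite -pi_ideal_gen_sum => /pi_ideal_gen_eq0/asboolP[b cb].
have /choice[d fd] i := fspan_full (b i).
(* [D] exceeds the weight of every box partition and all weights in the expansions of the products
   [b j * g j]. *)
pose D := ((\max_(la : box_partition k n) sumn (parts la)) +
  \sum_(i < k) (d i + (N + i.+1))).+1%N.
have : lspan (fun y => exists2 x : findex D,
    (val x).2 != [ffun=> ord0] & y = fmon (val x)) (\sum_i b i * g i).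
  apply: lspan_sum => j _; have := fspan_gM j (fd j).
  apply: lspan_trans => _ [la [e [la_box lae -> ej]]]; apply: lspan_gen.
  have laD : (sumn la + \sum_(i < k) e i * (N + i.+1) < D)%N.
    apply: leq_ltn_trans lae _; rewrite ltnS; apply: leq_trans (leq_addl _ _).
    by rewrite (bigD1 j) //= leq_addr.
  have [x xe ->] := fmon_index la_box laD; exists x => //.
  by apply: contraTneq ej => x0; rewrite -xe x0 ffunE.
case/(lspan_family (fun y Py => Py)) => e e0 be.
have emb_lt (la : box_partition k n) :
    (fweight (la, [ffun=> ord0] : {ffun 'I_k -> 'I_D}) < D)%N.
  rewrite /fweight /= big1 => [|i _]; last by rewrite ffunE.
  rewrite addn0 ltnS; apply: leq_trans (leq_addr _ _).
  exact: (@leq_bigmax _ (fun la : box_partition k n => sumn (parts la))).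
pose emb la : findex D := exist _ (la, [ffun=> ord0]) (emb_lt la).
(* The difference of the two expansions; at the zero exponent vector [e] vanishes, leaving [c]. *)
pose C x : R := (if (val x).2 == [ffun=> ord0] then c (val x).1 else 0) - e x.
have C0 : \sum_x C x *: fmon (val x) = 0.
  under eq_bigr do rewrite scalerBl.
  rewrite sumrB -be -cb; apply/eqP; rewrite subr_eq0; apply/eqP.
  rewrite (bigID (fun x => (val x).2 == [ffun=> ord0])) /= [X in _ + X]big1 ?addr0; last first.
    by move=> x /negPf->; rewrite scale0r.
  rewrite (reindex_onto emb (fun x => (val x).1)) /=; last first.
    by case=> -[la f] xD /= /eqP E; apply: val_inj; rewrite /= E.
  apply: eq_big => [la|la _]; rewrite ?eqxx // /fmon /=.
  by rewrite big1 ?mulr1 // => i _; rewrite ffunE expr0.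
move=> la; have := fmon_free C0 (emb la).
by rewrite /C /= eqxx e0 ?subr0 //= eqxx.
Qed.

(** Expand a lift of [v] in the family: a member with some [e j > 0] contains a factor [g j] and
    dies in the quotient. *)
Lemma box_family_spanning (v : ideal_gen_quot g) :
  exists c : box_partition k n -> R,
    v = \sum_la c la *: \pi_(ideal_gen_quot g) (hsym_part k R (parts la)).
Proof.
elim/quotW: v => x; have [d fx] := fspan_full x.
suff : lspan (fun y => exists2 la : box_partition k n, true &
    y = \pi_(ideal_gen_quot g) (hsym_part k R (parts la))) (\pi_(ideal_gen_quot g) x).
  by case/(lspan_family (fun y Py => Py)) => c _ ->; exists c.
elim: fx => [|c _ z [la [e [/in_box_partsP[mu ->] _ ->]]] _ IH].
  by rewrite (iffRL (pi_ideal_gen_eq0 _ _) (rpred0 _)); apply: lspan0.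
rewrite pi_addq pi_ideal_genZ; apply: lspanD => //; apply: lspanZ.
have [/forallP e0|] := boolP [forall i, e i == 0%N].
  apply: lspan_gen; exists mu => //; congr (\pi_(ideal_gen_quot g) _).
  by rewrite big1 ?mulr1 // => i _; rewrite (eqP (e0 i)) expr0.
rewrite negb_forall => /existsP[j ej].
rewrite (iffRL (pi_ideal_gen_eq0 _ _)); first exact: lspan0.
rewrite ideal_gen_mul // (bigD1 j) //= mulrC ideal_gen_mul //.
rewrite -(prednK (_ : 0 < e j)%N) ?lt0n // exprSr ideal_gen_mul //.
exact: (gen_ideal_gen g).
Qed.

End DeformedBasis.

(* Indices start at 0: a i is a_(i+1). Since msize p = deg p + 1 and           *)
(* msize 0 = 0, the hypothesis ha says that a_(i+1) has degree < n - k + (i+1). *)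
Theorem theorem9p9 (R : comNzRingType) (k n : nat) (hkn : (k <= n)%N)
    (a : 'I_k -> {sympoly R[k]})
    (ha : forall i : 'I_k, (msize (sympoly_val (a i)) <= n - k + i.+1)%N) :
  is_basis (fun la : box_partition k n =>
    \pi_(ideal_gen_quot (fun i : 'I_k => hsym k R (n - k + i.+1) - a i))
      (hsym_part k R (parts la))).
Proof.
by split; [apply: box_family_free | move=> v; apply: box_family_spanning].
Qed.
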